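(* Let $k$ be a field of prime characteristic $p$. Fix $n\geq 2$ and set $$R=\frac{k[t,x_1,\ldots,x_n]}{(f_1,\ldots,f_r)},$$ where $t,x_1,\ldots,x_n$ are variables and $f_1,\ldots,f_r$ are polynomials that are homogeneous with respect to the grading in which $\deg t=0$ and $\deg x_i=1$ for $i=1,\ldots,n$. Let $I=(x_1,\ldots,x_n)$. Then there is a constant $c$ such that for each $q=p^e$ there is a primary decomposition $$I^{[q]}=Q_1\cap Q_2\cap\cdots\cap Q_m$$ with the property that $(\sqrt{Q_i})^{c[q^{n-1}]}\subseteq Q_i$ for all $i=1,\ldots,m$.
   Context: For an ideal $J$ of a ring of prime characteristic $p$ and $q=p^e$ ($e\ge 0$ an integer), the Frobenius power $J^{[q]}$ is the ideal generated by the $q$th powers of generators of $J$. The notation $J^{c[q']}$, for $q'$ a power of $p$, means $(J^c)^{[q']}$, the $q'$th Frobenius power of the ordinary $c$th power of $J$; $c$ is a positive integer. The number $m$ of components may depend on $q$. *)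

(* Defs.v *)
From HB Require Import structures.
From mathcomp Require Import all_boot all_order all_algebra.
From mathcomp Require Import generic_quotient ring_quotient.
From mathcomp Require Import boolp classical_sets.
From mathcomp Require Import mpoly.

Set Implicit Arguments.
Unset Strict Implicit.
Unset Printing Implicit Defensive.

Import GRing.Theory.

Local Open Scope classical_set_scope.
Local Open Scope ring_scope.
Local Open Scope quotient_scope.

(* The ideals of the library (idealr) are proper and decidable. Here they are
   arbitrary, and rings may be trivial (comPzRingType), so that a quotient by
   the unit ideal is allowed. *)
Section Ideals.
Variable A : comPzRingType.
Implicit Types (S J : set A) (x y a : A).

Definition is_ideal J : Prop :=
  [/\ J 0, forall x y, J x -> J y -> J (x + y) & forall a x, J x -> J (a * x)].

Definition ideal_gen S : set A := smallest is_ideal S.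

Definition ideal_pow J (c : nat) : set A :=
  ideal_gen [set x | exists a : 'I_c -> A,
                       (forall i, J (a i)) /\ x = \prod_(i < c) a i].

(* All elements of J are taken as generators; by frob_power_gen below, any
   other generating set gives the same ideal in characteristic p. *)
Definition frob_power J (q : nat) : set A := ideal_gen [set x ^+ q | x in J].

Definition radical J : set A := [set x | exists N : nat, J (x ^+ N)].

Definition is_primary J : Prop :=
  [/\ is_ideal J, ~ J 1 & forall x y, J (x * y) -> J x \/ radical J y].

(* The empty intersection (m = 0) is the unit ideal. *)
Definition primary_decomposition J (m : nat) (Q : 'I_m -> set A) : Prop :=
  (forall i, is_primary (Q i)) /\ J = \bigcap_(i in [set: 'I_m]) Q i.

Lemma ideal_gen_ideal S : is_ideal (ideal_gen S).
Proof.
split=> [J [[]] //|x y Sx Sy J SJ|a x Sx J SJ].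
  by case: (SJ) => -[_ JD _] _; apply: JD; [apply: Sx | apply: Sy].
by case: (SJ) => -[_ _ JM] _; apply: JM; apply: Sx.
Qed.

Lemma ideal_gen_sub S : S `<=` ideal_gen S.
Proof. exact: sub_smallest. Qed.

Lemma ideal_gen_min S J : is_ideal J -> S `<=` J -> ideal_gen S `<=` J.
Proof. by move=> idJ SJ x; apply. Qed.

Lemma exprD_prime (p e : nat) x y : prime p -> p%:R = 0 :> A ->
  (x + y) ^+ (p ^ e) = x ^+ (p ^ e) + y ^+ (p ^ e).
Proof.
move=> p_pr p0; elim: e x y => [|e IHe] x y; first by rewrite !expr1.
rewrite expnSr !exprM IHe; set u := x ^+ _; set v := y ^+ _.
case: p p_pr p0 {IHe u v} (u) (v) => // p p_pr p0 u v.
rewrite exprDn big_ord_recl big_ord_recr /= subnn subn0 bin0 binn !mulr1n.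
rewrite expr0 mulr1 expr0 mul1r big1 ?add0r // => i _.
rewrite -mulr_natr; have /dvdnP[d ->] : (p.+1 %| 'C(p.+1, bump 0 i))%N.
  by apply: prime_dvd_bin; rewrite // /bump /= add1n ltnS ltn_ord.
by rewrite natrM p0 !mulr0.
Qed.

Lemma frob_power_gen (p e : nat) S : prime p -> p%:R = 0 :> A ->
  frob_power (ideal_gen S) (p ^ e) = ideal_gen [set x ^+ (p ^ e)%N | x in S].
Proof.
move=> p_pr p0; set T := [set x ^+ (p ^ e)%N | x in S].
have [J0 JD JM] := ideal_gen_ideal T.
apply/seteqP; split; apply: ideal_gen_min; try exact: ideal_gen_ideal.
  move=> _ [x Sx <-].
  apply: (@ideal_gen_min S [set y | ideal_gen T (y ^+ (p ^ e)%N)]) Sx; last first.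
    by move=> y Sy; apply: ideal_gen_sub; exists y.
  split=> [|y z Jy Jz|a y Jy] /=.
  - by rewrite -[(p ^ e)%N]prednK ?expn_gt0 ?prime_gt0 // exprS mul0r.
  - by rewrite exprD_prime //; apply: JD.
  - by rewrite exprMn; apply: JM.
move=> _ [x Sx <-]; apply: ideal_gen_sub; exists x => //.
exact: ideal_gen_sub.
Qed.

End Ideals.

Section QuotientRing.
Variables (A : comPzRingType) (S : set A).

Definition ideal_pred : {pred A} := fun x => `[< ideal_gen S x >].

Fact ideal_pred_zmod_closed : zmod_closed ideal_pred.
Proof.
have [J0 JD JM] := ideal_gen_ideal S.
split=> [|x y /asboolP Jx /asboolP Jy]; apply/asboolP => //.
by apply: JD => //; rewrite -mulN1r; apply: JM.
Qed.

HB.instance Definition _ :=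
  GRing.isZmodClosed.Build A ideal_pred ideal_pred_zmod_closed.

(* A / (S): the library's additive quotient, with multiplication added. *)
Definition quot_ring := Quotient.quot ideal_pred.
HB.instance Definition _ := GRing.Zmodule.on quot_ring.
HB.instance Definition _ := EqQuotient.on quot_ring.

Lemma quot_ringP (x y : A) :
  \pi_quot_ring x = \pi_quot_ring y <-> ideal_gen S (x - y).
Proof.
split=> [/eqP|Sxy].
  by rewrite -Quotient.idealrBE => /asboolP.
by apply/eqP; rewrite -Quotient.idealrBE; apply/asboolP.
Qed.

Definition quot_mul (u v : quot_ring) : quot_ring :=
  \pi_quot_ring (repr u * repr v).

Lemma quot_mulE x y :
  quot_mul (\pi_quot_ring x) (\pi_quot_ring y) = \pi_quot_ring (x * y).
Proof.
have [_ JD JM] := ideal_gen_ideal S.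
apply/quot_ringP; set x' := repr _; set y' := repr _.
have -> : x' * y' - x * y = y' * (x' - x) + x * (y' - y).
  by rewrite !mulrBr [y' * x']mulrC [y' * x]mulrC addrA subrK.
by apply: JD; apply: JM; apply/quot_ringP; rewrite reprK.
Qed.

Fact quot_mulA : associative quot_mul.
Proof.
move=> u v w; rewrite -[u]reprK -[v]reprK -[w]reprK.
move: (repr u) (repr v) (repr w) => x y z.
by rewrite (quot_mulE y z) (quot_mulE x (y * z)) (quot_mulE x y)
  (quot_mulE (x * y) z) mulrA.
Qed.

Fact quot_mulC : commutative quot_mul.
Proof. by move=> u v; rewrite /quot_mul mulrC. Qed.

Fact quot_mul1 : left_id (\pi_quot_ring 1) quot_mul.
Proof. by move=> u; rewrite -[u]reprK quot_mulE mul1r. Qed.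

Fact quot_piD (x y : A) :
  \pi_quot_ring (x + y) = \pi_quot_ring x + \pi_quot_ring y :> quot_ring.
Proof. exact: Quotient.pi_add. Qed.

Fact quot_mulDl : left_distributive quot_mul +%R.
Proof.
move=> u v w; rewrite -[u]reprK -[v]reprK -[w]reprK.
move: (repr u) (repr v) (repr w) => x y z.
by rewrite (quot_mulE x z) (quot_mulE y z) -(quot_piD x y)
  (quot_mulE (x + y) z) -quot_piD mulrDl.
Qed.

HB.instance Definition _ := GRing.Zmodule_isComPzRing.Build quot_ring
  quot_mulA quot_mulC quot_mul1 quot_mulDl.

Definition quot_pi (x : A) : quot_ring := \pi_quot_ring x.

Fact quot_pi_zmod_morphism : zmod_morphism quot_pi.
Proof.
move=> x y; apply/eqP; rewrite eq_sym subr_eq; apply/eqP.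
by rewrite -[RHS]quot_piD subrK.
Qed.

Fact quot_pi_monoid_morphism : monoid_morphism quot_pi.
Proof. by split=> [|x y]; last by symmetry; apply: quot_mulE. Qed.

HB.instance Definition _ :=
  GRing.isZmodMorphism.Build A quot_ring quot_pi quot_pi_zmod_morphism.
HB.instance Definition _ :=
  GRing.isMonoidMorphism.Build A quot_ring quot_pi quot_pi_monoid_morphism.

Lemma quot_pi_surj (u : quot_ring) : exists x, quot_pi x = u.
Proof. by exists (repr u); apply: reprK. Qed.

Lemma quot_pi_eq0 (x : A) : quot_pi x = 0 <-> ideal_gen S x.
Proof. by rewrite -{2}[x]subr0 -quot_ringP -/(quot_pi 0) rmorph0. Qed.

End QuotientRing.

(* In {mpoly k[n.+1]}, t is 'X_ord0 and the other variables are x_1, ..., x_n;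
   xdeg is the weight with deg t = 0 and deg x_i = 1. *)
Section XDegree.
Variable n : nat.

Definition xdeg (m : 'X_{1..n.+1}) : nat := (\sum_(i < n) m (lift ord0 i))%N.

Fact xdeg0 : xdeg 0%MM = 0%N.
Proof. by apply: big1 => i _; rewrite mnm0E. Qed.

Fact xdegD : {morph xdeg : m1 m2 / (m1 + m2)%MM >-> (m1 + m2)%N}.
Proof.
by move=> m1 m2; rewrite /xdeg -big_split; apply: eq_bigr => i _; rewrite mnmDE.
Qed.

HB.instance Definition _ := isMeasure.Build n.+1 xdeg xdeg0 xdegD.

End XDegree.

Definition hquot (k : fieldType) (n r : nat)
    (f : 'I_r -> {mpoly k[n.+1]}) : comPzRingType :=
  quot_ring (range f).

Definition xideal (k : fieldType) (n r : nat)
    (f : 'I_r -> {mpoly k[n.+1]}) : set (hquot f) :=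
  ideal_gen (range (fun i : 'I_n => quot_pi (range f) 'X_(lift ord0 i))).

Arguments hquot {k n r} f.
Arguments xideal {k n r} f _.

(* Main.v *)
Require Import Defs.
From HB Require Import structures.
From mathcomp Require Import all_boot all_order all_fingroup all_algebra.
From mathcomp Require Import boolp classical_sets.
From mathcomp Require Import mpoly.
From mathcomp Require Import ring.

(** Why the theorem holds.

    Write J for the Frobenius power of I = (x_1, ..., x_n) with exponent q.
    Every element of R is congruent modulo I to a polynomial h(t), and raising
    such a congruence to the power q turns it into a congruence modulo J.  Hence,
    modulo an ideal containing J, an element is regular or nilpotent as soon as
    the polynomial h(t) to which it is congruent is, and primary ideals can be
    recognized on k[t].

    Suppose that one polynomial G = (g_1 ... g_s)^N, with distinct irreducible
    g_i, kills all the k[t]-torsion of R/J.  Then J is the intersection of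
    (J : G) and of the ideals J + (g_i^N): if u lies in all of them, coprimality
    gives u = G w modulo J, hence w is torsion, hence G w and u lie in J.  The
    first ideal is (x)-primary and the others are (x, g_i)-primary, except for
    those equal to the unit ideal, which are dropped.  A product of c elements of the radical of
    such a component is g^c s + i with i in I, where g = 0 or g = g_i; its power
    with exponent q^(n-1) is in the component as soon as N = c q^(n-1), because
    q divides q^(n-1).  This is frobenius_decomposition.

    It remains to kill the torsion of R/J by a polynomial in which each
    irreducible factor has an exponent linear in q^(n-1).  The x-grading splits
    R/J into its components of degree d.  Such a component is presented over
    k[t] by the monomials of degree d with all exponents below q as generators,
    and by the multiples of the f_j as relations.  There are at most q^(n-1)
    generators, since one exponent is determined by the others and by d.
    The coefficients of the relations have t-degree at most some D which depends
    on f only.  A nonzero minor of maximal size of the matrix of relations kills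
    the torsion by Cramer's rule (torsion_killer), and it has degree at most
    D q^(n-1); the exponents of its irreducible factors are no larger.  As these
    exponents do not add up when d varies, the constant c = D + 1 works. *)

Set Implicit Arguments.
Unset Strict Implicit.
Unset Printing Implicit Defensive.

Import GRing.Theory.

Local Open Scope classical_set_scope.
Local Open Scope ring_scope.

(** * Torsion of finitely presented modules over K[t] *)

Section Torsion.
Variable K : fieldType.
Local Notation F := {fraction {poly K}}.

Definition is_submod N (L : set 'rV[{poly K}]_N) : Prop :=
  [/\ L 0, forall v w, L v -> L w -> L (v + w)
    & forall a v, L v -> L (a *: v)].

Definition span N (X : set 'rV[{poly K}]_N) : set 'rV[{poly K}]_N :=
  smallest (@is_submod N) X.

Lemma span_submod N (X : set 'rV[{poly K}]_N) : is_submod (span X).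
Proof.
split=> [L [[]] //|v w Xv Xw L XL|a v Xv L XL].
  by case: (XL) => -[_ LD _] _; apply: LD; [apply: Xv | apply: Xw].
by case: (XL) => -[_ _ LZ] _; apply: LZ; apply: Xv.
Qed.

Lemma span_sum N (X : set 'rV[{poly K}]_N) (I : Type) (s : seq I)
    (P : pred I) (v : I -> 'rV[{poly K}]_N) :
  (forall i, P i -> span X (v i)) -> span X (\sum_(i <- s | P i) v i).
Proof.
have [L0 LD _] := span_submod X.
by move=> Xv; apply: big_ind.
Qed.

Lemma size_det_leq r D (B : 'M[{poly K}]_r) :
  (forall i j, size (B i j) <= D.+1)%N -> (size (\det B) <= (D * r).+1)%N.
Proof.
move=> szB; apply: (leq_trans (size_sum _ _ _)); apply/bigmax_leqP => s _.
have -> : size ((-1) ^+ perm.odd_perm s * \prod_i B i (s i)) = size (\prod_i B i (s i)).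
  by case: (perm.odd_perm s); rewrite ?expr1 ?mulN1r ?size_polyN // expr0 mul1r.
apply: (leq_trans (size_poly_prod_leq _ _)).
rewrite card_ord leq_subLR addnS ltnS.
apply: (@leq_trans (\sum_(i < r) D.+1)); first exact: leq_sum.
by rewrite sum_nat_const card_ord mulnS [(D * r)%N]mulnC.
Qed.

(** The row vectors of X are the relations of a module with N generators over
    K[t].  Among them choose r rows, as many as possible, that are independent
    over K(t), and a nonzero minor of size r of these rows: its degree is at
    most D r, and r <= N.  A vector with a nonzero multiple in the span of X is
    a K(t)-combination of the chosen rows, and by Cramer's rule the minor clears
    the denominators of its coefficients. *)
Lemma torsion_killer N D (X : set 'rV[{poly K}]_N) :
    (forall v, X v -> forall i, (size (v ord0 i) <= D.+1)%N) ->
  exists delta : {poly K},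
    [/\ delta != 0, (size delta <= (D * N).+1)%N
      & forall h v, h != 0 -> span X (h *: v) -> span X (delta *: v)].
Proof.
move=> szX; pose fr := map_mx (@tofrac {poly K}).
have fr_inj m n : injective (fr m n).
  move=> C C' /matrixP eqC; apply/matrixP=> i j.
  by have /eqP := eqC i j; rewrite !mxE tofrac_eq => /eqP.
pose indep r := `[< exists A : 'M[{poly K}]_(r, N),
  (forall i, X (row i A)) /\ row_free (fr _ _ A : 'M[F]_(r, N)) >].
have indep0 : exists r, indep r.
  exists 0%N; apply/asboolP; exists 0; split=> [[]//|].
  by rewrite /row_free flatmx0 mxrank0.
have indep_le r : indep r -> (r <= N)%N.
  by move=> /asboolP [A [_ /eqP <-]]; apply: rank_leq_col.
have [r /asboolP[A [XA freeA]] r_max] := ex_maxnP indep0 indep_le.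
have subA v : X v -> (fr _ _ v <= fr _ _ A)%MS.
  move=> Xv; apply/negPn/negP => vA.
  (* otherwise A extended by v would be a larger independent family *)
  suff: indep (r + 1)%N by move/r_max; rewrite addn1 ltnn.
  apply/asboolP; exists (col_mx A v); split=> [i|].
    rewrite -(splitK i); case: (fintype.split i) => j /=.
      by rewrite rowKu.
    by rewrite rowKd row_id.
  rewrite /fr map_col_mx -/(fr _ _ A) -/(fr _ _ v) -row_leq_rank.
  move: vA freeA; set a := fr _ _ A; set b := fr _ _ v => vA /eqP freeA.
  rewrite -addsmxE addn1.
  have : (a < a + b)%MS.
    by rewrite /ltmx addsmxSl /=; apply: contra vA; apply: submx_trans (addsmxSr _ _).
  by rewrite ltmxErank freeA => /andP[].
have fullT : row_full (fr _ _ A)^T.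
  by rewrite /row_full mxrank_tr.
pose g := fullrankfun fullT; pose B := colsub g A.
have frB : fr _ _ B = (rowsub g (fr _ _ A)^T)^T.
  by apply/matrixP=> i j; rewrite !mxE.
have detB : \det B != 0.
  have := fullrowsub_unit fullT; rewrite -unitmx_tr -frB unitmxE unitfE.
  by rewrite det_map_mx tofrac_eq0.
exists (\det B); split=> // [|h v h0 Xhv].
  apply: (@leq_trans (D * r).+1); last first.
    by rewrite ltnS leq_mul2l indep_le ?orbT //; apply/asboolP; exists A.
  apply: size_det_leq => i j; rewrite !mxE.
  by have := szX _ (XA i) (g j); rewrite mxE.
have sub_h : (fr _ _ (h *: v) <= fr _ _ A)%MS.
  apply: (Xhv [set w | (fr _ _ w <= fr _ _ A)%MS]); split=> //.
  split=> [|w w'|a w] /=; first by rewrite /fr map_mx0 sub0mx.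
    by move=> Aw Aw'; rewrite /fr map_mxD addmx_sub.
  by move=> Aw; rewrite /fr map_mxZ scalemx_sub.
have : (fr _ _ v <= fr _ _ A)%MS.
  move: sub_h; rewrite /fr map_mxZ; set b := map_mx _ v => sub_h.
  have <- : (tofrac h)^-1 *: (tofrac h *: b) = b.
    by rewrite scalerA mulVf ?scale1r // tofrac_eq0.
  exact: scalemx_sub.
move=> /submxP[y vy].
have vyB : fr _ _ (colsub g v) = y *m fr _ _ B.
  rewrite /fr map_mxsub -/(fr _ _ v) vy.
  by apply/rowP=> j; rewrite !mxE; apply: eq_bigr => i _; rewrite !mxE.
have -> : \det B *: v = colsub g v *m \adj B *m A.
  apply: fr_inj; rewrite /fr !map_mxM map_mxZ map_mx_adj -/(fr _ _ A) -/(fr _ _ B).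
  rewrite -/(fr _ _ v) -/(fr _ _ (colsub g v)) vyB -[y *m _ *m _]mulmxA mul_mx_adj.
  by rewrite mul_mx_scalar -scalemxAl -vy det_map_mx.
rewrite mulmx_sum_row; apply: span_sum => i _.
by case: (span_submod X) => _ _; apply; move=> L [_]; apply.
Qed.

End Torsion.

(** * Coprime factorization of univariate polynomials *)

Section PolyFactors.
Variable K : fieldType.
Implicit Types p q s g d : {poly K}.

(** The multiplicity of an irreducible factor of d is at most the degree of d,
    so the exponent M, however large, can be replaced by this degree.  The
    induction splits off gcd(d, s) instead of irreducible factors. *)
Lemma dvdp_exp_bound s N M d :
  d != 0 -> (size d <= N.+1)%N -> d %| s ^+ M -> d %| s ^+ N.
Proof.
elim: N d => [|N IHN] d d0 szd ds.
  by rewrite expr0 dvdp1 eqn_leq szd lt0n size_poly_eq0.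
have [cop|ncop] := boolP (coprimep d s).
  apply: dvdp_trans (dvd1p _); rewrite dvdp1 -coprimepp.
  by apply: coprimep_dvdl ds _; apply: coprimep_expr.
have [d' def_d] := dvdpP _ _ (dvdp_gcdl d s).
have d'0 : d' != 0 by apply: contraNneq d0 => d'0; rewrite def_d d'0 mul0r.
have g0 : gcdp d s != 0 by rewrite gcdp_eq0 (negPf d0).
rewrite exprS {1}def_d mulrC; apply: dvdp_mul; first exact: dvdp_gcdr.
apply: IHN => //; last by apply: dvdp_trans ds; rewrite [X in _ %| X]def_d dvdp_mulr.
have g_gt1 : (1 < size (gcdp d s))%N.
  by move: ncop; rewrite coprimep_def neq_ltn ltnS leqn0 size_poly_eq0 (negPf g0).
move: szd; rewrite {1}def_d size_mul // -subn1 leq_subLR add1n => szd.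
rewrite -(leq_add2r 2) [(N.+1 + 2)%N]addn2; apply: leq_trans szd; by rewrite leq_add2l.
Qed.

Lemma irreducible_divisor p :
  (1 < size p)%N -> exists2 g, irreducible_poly g & g %| p.
Proof.
have [n] := ubnP (size p); elim: n p => // n IHn p szp p_gt1.
have [irr|] := pselect (irreducible_poly p); first by exists p.
move=> nirr; have [d [d_gt1 dp ndp]] : exists d,
    [/\ size d != 1%N, d %| p & ~~ (d %= p)].
  apply: contrapT => nd; apply: nirr; split=> // d d1 dp.
  by apply: contrapT => /negP ndp; apply: nd; exists d.
have p0 : p != 0 by rewrite -size_poly_gt0 (ltn_trans _ p_gt1).
have d0 : d != 0 by apply: contraTneq dp => ->; rewrite dvd0p.
have dlt : (size d < size p)%N.
  by rewrite ltn_neqAle dvdp_leq // andbT dvdp_size_eqp.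
have [||g irr gd] := IHn d.
- exact: leq_trans dlt szp.
- by rewrite ltn_neqAle eq_sym d_gt1 size_poly_gt0.
by exists g => //; apply: dvdp_trans gd dp.
Qed.

Lemma irreducible_coprimep g p : irreducible_poly g -> ~~ (g %| p) -> coprimep g p.
Proof.
move=> [g_gt1 irr] ngp; rewrite coprimep_def; apply/negPn/negP => n1.
have /eqp_dvdl e := irr _ n1 (dvdp_gcdl g p).
by move: ngp; rewrite -e dvdp_gcdr.
Qed.

(** An irreducible factor is split off together with its full power, so that
    it is coprime to the cofactor and to all the factors found later. *)
Lemma coprime_factorization p : p != 0 ->
  exists gs : seq {poly K},
    [/\ forall g, g \in gs -> irreducible_poly g,
        pairwise (@coprimep K) gs
      & exists M, p %| (\prod_(g <- gs) g) ^+ M].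
Proof.
(* the factors must divide p for coprimality to pass to them *)
suff: p != 0 -> exists gs : seq {poly K},
    [/\ forall g, g \in gs -> irreducible_poly g /\ g %| p,
        pairwise (@coprimep K) gs
      & exists M, p %| (\prod_(g <- gs) g) ^+ M].
  by move=> H /H [gs [h1 h2 h3]]; exists gs; split=> // g /h1[].
have [n] := ubnP (size p); elim: n p => // n IHn p szp p0.
have [p_le1|p_gt1] := leqP (size p) 1.
  exists [::]; split=> //; exists 0%N; rewrite expr0.
  by rewrite dvdp1 eqn_leq p_le1 size_poly_gt0.
have [g irr gp] := irreducible_divisor p_gt1.
have g_gt1 := irr.1.
pose P m := g ^+ m %| p.
have P0 : exists m, P m by exists 0%N; rewrite /P expr0 dvd1p.
have Pb m : P m -> (m <= size p)%N.
  move=> /(dvdp_leq p0); apply: leq_trans.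
  apply: leq_trans (leq_pred _); rewrite size_exp.
  by rewrite leq_pmull // -subn1 subn_gt0.
have [m /dvdpP[p' def_p] m_max] := ex_maxnP P0 Pb.
have m_gt0 : (0 < m)%N by apply: m_max; rewrite /P expr1.
have p'0 : p' != 0 by apply: contraNneq p0 => z; rewrite def_p z mul0r.
have g0 : g != 0 by rewrite -size_poly_gt0 (ltn_trans _ g_gt1).
have ngp' : ~~ (g %| p').
  apply/negP => gp'; suff /m_max : P m.+1 by rewrite ltnn.
  by rewrite /P def_p exprS dvdp_mul.
have p'p : p' %| p by rewrite def_p dvdp_mulr.
have sz' : (size p' < n)%N.
  rewrite ltnS in szp; apply: leq_trans szp.
  rewrite ltn_neqAle dvdp_leq // andbT dvdp_size_eqp //; apply/negP => /eqp_dvdr e.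
  by move: ngp'; rewrite e gp.
have [gs [gsP gs_cop [M p'M]]] := IHn p' sz' p'0.
exists (g :: gs); split.
- move=> g'; rewrite inE => /predU1P[-> //|/gsP[irr' g'p']].
  by split=> //; apply: dvdp_trans p'p.
- rewrite /= gs_cop andbT; apply/allP => g' /gsP[_ g'p'].
  by apply: coprimep_dvdl g'p' _; apply: irreducible_coprimep.
exists (M + m)%N; rewrite big_cons exprMn def_p mulrC.
apply: dvdp_mul; last by apply: dvdp_trans p'M _; apply: dvdp_exp2l; rewrite leq_addr.
by apply: dvdp_exp2l; rewrite leq_addl.
Qed.

Lemma coprimep_prod_seq g (gs : seq {poly K}) :
  all (coprimep g) gs -> coprimep g (\prod_(x <- gs) x).
Proof.
elim: gs => [|x gs IH] /=; first by rewrite big_nil coprimep1.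
by case/andP=> gx /IH gg; rewrite big_cons coprimepMr gx.
Qed.

End PolyFactors.

(** * Primary decomposition of a Frobenius power *)

Section Congruences.
Variables (A : comPzRingType) (L : set A).
Hypothesis idL : is_ideal L.

Lemma idealN x : L x -> L (- x).
Proof. by case: idL => _ _ LM Lx; rewrite -mulN1r; apply: LM. Qed.

Lemma idealB x y : L x -> L y -> L (x - y).
Proof. by case: idL => _ LD _ Lx /idealN; apply: LD. Qed.

Lemma ideal_congr_mem x y : L (x - y) -> L y -> L x.
Proof. by case: idL => _ LD _ Lxy /(LD _ _ Lxy); rewrite subrK. Qed.

Lemma ideal_congr_sym x y : L (x - y) -> L (y - x).
Proof. by move/idealN; rewrite opprB. Qed.

Lemma ideal_congrM x y z t : L (x - y) -> L (z - t) -> L (x * z - y * t).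
Proof.
case: idL => _ LD LM Lxy Lzt.
have -> : x * z - y * t = z * (x - y) + y * (z - t) by ring.
by apply: LD; apply: LM.
Qed.

Lemma ideal_congrX x y n : L (x - y) -> L (x ^+ n - y ^+ n).
Proof.
move=> Lxy; elim: n => [|n IHn]; last by rewrite !exprS; apply: ideal_congrM.
by rewrite subrr; case: idL.
Qed.

Lemma ideal_congr_prod n (a b : 'I_n -> A) :
  (forall i, L (a i - b i)) -> L (\prod_i a i - \prod_i b i).
Proof.
move=> Lab; apply: (big_ind2 (fun x y => L (x - y))) => // [|x y z t].
  by rewrite subrr; case: idL.
exact: ideal_congrM.
Qed.

Lemma idealX x n : L x -> (0 < n)%N -> L (x ^+ n).
Proof. by case: idL n => _ _ LM [//|n] Lx _; rewrite exprSr; apply: LM. Qed.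

End Congruences.

Section Decomposition.
Variable A : comPzRingType.

(** Components equal to the unit ideal may be listed: they are dropped. *)
Lemma primary_decomposition_seq (P : set A -> Prop) (J : set A) (Qs : seq (set A)) :
    (forall Q, Q \in Qs -> is_ideal Q) ->
    (forall Q, Q \in Qs -> ~ Q 1 -> is_primary Q /\ P Q) ->
    J = [set u | forall Q, Q \in Qs -> Q u] ->
  exists (m : nat) (Q : 'I_m -> set A),
    primary_decomposition J Q /\ forall i, P (Q i).
Proof.
move=> idQ goodQ ->; pose s := [seq Q <- Qs | `[< ~ Q 1 >]].
have sP i : tnth (in_tuple s) i \in Qs /\ ~ tnth (in_tuple s) i 1.
  have := mem_tnth i (in_tuple s).
  by rewrite mem_filter => /andP[/asboolP].
exists (size s), (tnth (in_tuple s)); split; [split|] => [i||i].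
- by have [/goodQ h /h[]] := sP i.
- apply/seteqP; split=> u /= Qu => [i _|Q QsQ].
    by have [/Qu] := sP i.
  have [Q1|nQ1] := pselect (Q 1).
    by have [_ _ QM] := idQ _ QsQ; rewrite -[u]mulr1; apply: QM.
  have /tnthP[i ->] : Q \in in_tuple s by rewrite mem_filter QsQ andbT; apply/asboolP.
  exact: Qu.
by have [/goodQ h /h[]] := sP i.
Qed.

Variables (K : fieldType) (tau : {rmorphism {poly K} -> A}).

(** Chinese remainders: for coprime g and h, the ideals L + (g) and L + (h)
    meet in L + (g h), by a Bezout relation between g and h. *)
Lemma bigcap_coprime (gs : seq {poly K}) (L : set A) u : is_ideal L ->
    pairwise (@coprimep K) gs ->
    (forall g, g \in gs -> exists w, L (u - tau g * w)) ->
  exists w, L (u - tau (\prod_(g <- gs) g) * w).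
Proof.
move=> idL; have [L0 LD LM] := idL.
elim: gs => [|g gs IHgs] /=.
  by exists u; rewrite big_nil rmorph1 mul1r subrr.
case/andP=> /coprimep_prod_seq cop /IHgs{}IHgs Lu.
have [|w2 Lw2] := IHgs; first by move=> g' gs'; apply: Lu; rewrite inE gs' orbT.
have [w1 Lw1] := Lu g (mem_head _ _).
rewrite big_cons; set h := \prod_(_ <- _) _ in cop Lw2 *.
have /Bezout_eq1_coprimepP[[a b] /= ab1] := cop.
exists (tau a * w2 + tau b * w1).
have tab1 : tau a * tau g + tau b * tau h = 1 by rewrite -!rmorphM -rmorphD ab1 rmorph1.
have -> : u - tau (g * h) * (tau a * w2 + tau b * w1)
    = tau a * tau g * (u - tau h * w2) + tau b * tau h * (u - tau g * w1).
  by rewrite -{1}[u]mul1r -tab1 rmorphM; ring.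
by apply: LD; apply: LM.
Qed.

Variables (p : nat) (I : set A) (e : nat).
Hypotheses (p_pr : prime p) (p0 : p%:R = 0 :> A).
Hypotheses (idI : is_ideal I) (sumI : forall v, exists v0, I (v - tau v0)).
Local Notation q := (p ^ e)%N.
Local Notation J := (frob_power I q).

Lemma frob_congr v w n : I (v - w) ->
  frob_power I (p ^ n) (v ^+ (p ^ n) - w ^+ (p ^ n)).
Proof.
move=> Ivw; rewrite -{1}[v](subrK w) (exprD_prime _ _ _ p_pr p0) addrK.
by apply: ideal_gen_sub; exists (v - w).
Qed.

Lemma frob_power_antimono m n : (m <= n)%N ->
  frob_power I (p ^ n) `<=` frob_power I (p ^ m).
Proof.
move=> mn; apply: ideal_gen_min; first exact: ideal_gen_ideal.
move=> _ [x Ix <-]; have [_ _ JM] := ideal_gen_ideal [set x ^+ (p ^ m)%N | x in I].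
rewrite -(subnK (leq_pexp2l (prime_gt0 p_pr) mn)) exprD.
by apply: JM; apply: ideal_gen_sub; exists x.
Qed.

(** A component over a prime g of K[t].  The case g = 0 is the component with
    radical I, and the case g irreducible the one with radical I + (g).
    Modulo Q an element y congruent to tau h modulo I satisfies
    y^q = (tau h)^q, so y is nilpotent if g divides h and is regular
    otherwise. *)
Lemma primary_over_prime (Q : set A) (g : {poly K}) c e' :
    is_ideal Q -> J `<=` Q -> (e <= e')%N ->
    Q (tau g ^+ (c * p ^ e')) ->
    (forall h, ~~ (g %| h) -> forall u, Q (tau h * u) -> Q u) ->
    ~ Q 1 ->
  is_primary Q /\ frob_power (ideal_pow (radical Q) c) (p ^ e') `<=` Q.
Proof.
move=> idQ JQ ee' Qg regQ Q1; have [Q0 QD QM] := idQ.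
have q_gt0 n : (0 < p ^ n)%N by rewrite expn_gt0 prime_gt0.
have regX h n u : ~~ (g %| h) -> Q (tau h ^+ n * u) -> Q u.
  move=> gh; elim: n => [|n IHn]; first by rewrite expr0 mul1r.
  by rewrite exprS -mulrA => /(regQ _ gh).
have congrQ v h n : I (v - tau h) -> Q (v ^+ (q * n) - tau h ^+ (q * n)).
  move=> Ivh; rewrite !exprM; apply: (ideal_congrX idQ).
  by apply: JQ; apply: frob_congr.
have radQ v h : I (v - tau h) -> radical Q v -> g %| h.
  move=> Ivh [n Qv]; apply/negPn/negP => gh; apply: Q1.
  apply: (regX h (q * n)%N) => //; rewrite mulr1.
  apply: ideal_congr_mem (ideal_congr_sym idQ (congrQ _ _ n Ivh)) _ => //.
  by rewrite mulnC exprM; apply: idealX.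
split; first split=> // x y Qxy.
  have [h Ih] := sumI y; have [/dvdpP[s def_h]|gh] := boolP (g %| h).
    right; exists (q * (c * p ^ e'))%N.
    apply: ideal_congr_mem (congrQ _ _ _ Ih) _ => //.
    rewrite def_h rmorphM exprMn; apply: QM.
    by rewrite mulnC exprM; apply: idealX.
  left; apply: (regX h (q * 1)%N) => //.
  have Qhy : Q (tau h ^+ (q * 1) * x - y ^+ (q * 1) * x).
    rewrite -mulrBl mulrC; apply: QM.
    by apply: ideal_congr_sym => //; apply: congrQ.
  apply: ideal_congr_mem Qhy _ => //.
  by rewrite muln1 -[q]prednK // exprSr -mulrA [y * x]mulrC; apply: QM.
rewrite (frob_power_gen _ _ p_pr p0); apply: ideal_gen_min => // _ [_ [a [Qa ->]] <-].
have /boolp.choice[s Is] : forall i, exists s, I (a i - tau g * s).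
  move=> i; have [h Ih] := sumI (a i); have /dvdpP[s def_h] := radQ _ _ Ih (Qa i).
  by exists (tau s); rewrite -rmorphM mulrC -def_h.
(* a product of c elements of the radical is g^c s modulo I *)
have := @frob_congr _ _ e' (ideal_congr_prod idI Is).
move=> /(frob_power_antimono ee') /JQ Qa_s; apply: ideal_congr_mem Qa_s _ => //.
rewrite big_split prodr_const card_ord /= exprMn -exprM mulrC.
exact: QM.
Qed.

(** Once G = (g_1 ... g_s)^N kills the torsion modulo J, the components are
    (J : G) and the J + (g_i^N). *)
Lemma frobenius_decomposition (gs : seq {poly K}) c e' :
    (0 < c)%N -> (e <= e')%N ->
    (forall g, g \in gs -> irreducible_poly g) -> pairwise (@coprimep K) gs ->
    (forall h u, h != 0 -> J (tau h * u) ->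
       J (tau ((\prod_(g <- gs) g) ^+ (c * p ^ e')) * u)) ->
  exists (m : nat) (Q : 'I_m -> set A),
    primary_decomposition J Q /\
    forall i, frob_power (ideal_pow (radical (Q i)) c) (p ^ e') `<=` Q i.
Proof.
set N := (c * p ^ e')%N; set G := _ ^+ N => c_gt0 ee' irr cop killG.
have N_gt0 : (0 < N)%N by rewrite muln_gt0 c_gt0 expn_gt0 prime_gt0.
have idJ : is_ideal J by apply: ideal_gen_ideal.
have [J0 JD JM] := idJ.
pose Q0 := [set u | J (tau G * u)].
pose Q g := [set u | exists w, J (u - tau (g ^+ N) * w)].
have G0 : G != 0.
  rewrite expf_neq0 // prodf_seq_eq0.
  apply/hasP => -[g /irr[g_gt1 _] /= /eqP g0].
  by move: g_gt1; rewrite g0 size_poly0.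
have idQ0 : is_ideal Q0.
  split=> [|x y|a x]; rewrite /Q0 /= ?mulr0 ?mulrDr //; first exact: JD.
  by rewrite mulrCA; apply: JM.
have JQ0 : J `<=` Q0 by move=> u; apply: JM.
have idQ g : is_ideal (Q g).
  split=> [|x y [w Jw] [w' Jw']|a x [w Jw]]; first by exists 0; rewrite mulr0 subr0.
    exists (w + w'); have := JD _ _ Jw Jw'; congr J; ring.
  exists (a * w); have := JM a _ Jw; congr J; ring.
have JQ g : J `<=` Q g by move=> u Ju; exists 0; rewrite mulr0 subr0.
apply: (@primary_decomposition_seq
  (fun Q => frob_power (ideal_pow (radical Q) c) (p ^ e') `<=` Q)
  J (Q0 :: [seq Q g | g <- gs])).
- by move=> B; rewrite inE => /predU1P[->//|/mapP[g _ ->]].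
- move=> B; rewrite inE => /predU1P[->|/mapP[g gsg ->]].
    apply: (@primary_over_prime _ 0) => //.
      by rewrite rmorph0 expr0n eqn0Ngt N_gt0; case: idQ0.
    move=> h; rewrite dvd0p => h0 u; rewrite /Q0 /= mulrA -rmorphM.
    by apply: killG; rewrite mulf_neq0.
  apply: (@primary_over_prime _ g) => // [|h gh u [w Jw]].
    by exists 1; rewrite mulr1 rmorphXn subrr.
  have /(coprimep_expl N)/Bezout_eq1_coprimepP[[a b] /= ab1] :=
    irreducible_coprimep (irr _ gsg) gh.
  have tab1 : tau a * tau (g ^+ N) + tau b * tau h = 1.
    by rewrite -!rmorphM -rmorphD ab1 rmorph1.
  exists (tau a * u + tau b * w); have := JM (tau b) _ Jw; congr J.
  by rewrite -[X in _ = X - _]mul1r -tab1; ring.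
apply/seteqP; split=> u /= => [Ju B|Qu].
  by rewrite inE => /predU1P[->|/mapP[g _ ->]]; [apply: JQ0 | apply: JQ].
have Q0u : Q0 u by apply: Qu; rewrite inE eqxx.
have [||w Jw] := @bigcap_coprime [seq g ^+ N | g <- gs] J u idJ.
- rewrite pairwise_map; apply: sub_pairwise cop => g g' /= gg'.
  by apply/coprimep_expl/coprimep_expr.
- move=> _ /mapP[g gsg ->].
  by apply: (Qu (Q g)); rewrite inE map_f ?orbT.
(* u = G w modulo J, and G u lies in J, so w is a torsion element *)
move: Jw; rewrite big_map prodrXl -/G => Jw.
apply: (ideal_congr_mem idJ Jw); apply: (killG (G * G)); first by rewrite mulf_neq0.
have -> : tau (G * G) * w = tau G * u - tau G * (u - tau G * w).
  by rewrite rmorphM; ring.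
exact: (JD _ _ Q0u (idealN idJ (JM _ _ Jw))).
Qed.

End Decomposition.

(** * Torsion in the graded pieces *)

Section TruncatedCoordinates.
Variables (K : fieldType) (n q : nat).
Local Notation R := {poly K}.
Local Notation S := {mpoly R[n.+1]}.
Implicit Types (P s : S) (a : {ffun 'I_n.+1 -> 'I_q}) (d : nat).

(** The functions a into 'I_q enumerate the monomials with all exponents below
    q, which form a basis of S modulo the ideal of qpowers. *)
Definition box_mnm a : 'X_{1..n.+1} := [multinom (a j : nat) | j < n.+1].

Definition box d : {set {ffun 'I_n.+1 -> 'I_q}} :=
  [set a | mdeg (box_mnm a) == d].

Definition coords d P : 'rV[R]_#|box d| :=
  \row_i P@_(box_mnm (enum_val i)).

Definition of_coords d (v : 'rV[R]_#|box d|) : S :=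
  \sum_i v ord0 i *: 'X_[box_mnm (enum_val i)].

Definition qpowers : set S := range (fun i : 'I_n.+1 => 'X_i ^+ q).

Lemma mcoeffMXE P m k :
  (P * 'X_[m])@_k = if (m <= k)%MM then P@_(k - m) else 0.
Proof.
case: ifP => [mk|nmk].
  by rewrite -{1}(submK mk) addmC mcoeffMX.
apply: memN_msupp_eq0; apply/negP; rewrite (perm_mem (msuppMX _ _)).
by case/mapP=> m' _ def_k; rewrite def_k lem_addr in nmk.
Qed.

Lemma mpolyX_qpowers (j : 'I_n.+1) (m : 'X_{1..n.+1}) : (q <= m j)%N -> 
  ideal_gen qpowers ('X_[m] : S).
Proof.
move=> qm; have [_ _ bM] := ideal_gen_ideal qpowers.
have /submK <- : (U_(j) *+ q <= m)%MM.
  apply/mnm_lepP => i; rewrite mulmnE mnm1E.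
  by case: eqP => [<-|]; rewrite ?mul1n.
rewrite mpolyXD -mpolyXn; apply: bM.
by apply: ideal_gen_sub; exists j.
Qed.

Lemma box_mnm_inj : injective box_mnm.
Proof.
by move=> a b /mnmP eab; apply/ffunP=> j; apply: val_inj; have := eab j; rewrite !mnmE.
Qed.

Lemma box_mnmP (m : 'X_{1..n.+1}) : (forall j, (m j < q)%N) -> exists a, m = box_mnm a.
Proof.
move=> mq; exists [ffun j => Ordinal (mq j)].
by apply/mnmP=> j; rewrite mnmE ffunE.
Qed.

Lemma coordsD d : {morph coords d : P Q / P + Q}.
Proof. by move=> P Q; apply/rowP=> i; rewrite !mxE mcoeffD. Qed.

Lemma coordsZ d c P : coords d (c *: P) = c *: coords d P.
Proof. by apply/rowP=> i; rewrite !mxE mcoeffZ. Qed.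

Lemma coords0 d : coords d 0 = 0.
Proof. by apply/rowP=> i; rewrite !mxE mcoeff0. Qed.

Lemma of_coordsD d : {morph @of_coords d : v w / v + w}.
Proof.
by move=> v w; rewrite -big_split; apply: eq_bigr => i _; rewrite mxE scalerDl.
Qed.

Lemma of_coordsZ d c (v : 'rV_#|box d|) : of_coords (c *: v) = c *: of_coords v.
Proof. by rewrite scaler_sumr; apply: eq_bigr => i _; rewrite mxE scalerA. Qed.

Lemma of_coords0 d : of_coords (0 : 'rV_#|box d|) = 0.
Proof. by apply: big1 => i _; rewrite mxE scale0r. Qed.

(** The first exponent is determined by the others and by the degree; this is
    the only source of the exponent n, one less than the number of
    variables. *)
Lemma card_box d : (#|box d| <= q ^ n)%N.
Proof.
have <- : #|{ffun 'I_n -> 'I_q}| = (q ^ n)%N by rewrite card_ffun !card_ord.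
pose tail a : {ffun 'I_n -> 'I_q} := [ffun j => a (lift ord0 j)].
rewrite -(@card_in_imset _ _ tail) ?max_card // => a b.
rewrite !inE => /eqP da /eqP db /ffunP eq_ab.
have eq_lift j : a (lift ord0 j) = b (lift ord0 j).
  by have := eq_ab j; rewrite !ffunE.
apply/ffunP=> j; case: (unliftP ord0 j) => [i ->|->]; first exact: eq_lift.
apply: val_inj; move: da; rewrite -db !mdegE !big_ord_recl !mnmE /=.
rewrite (eq_bigr (fun i => box_mnm b (lift ord0 i))); last first.
  by move=> i _; rewrite !mnmE eq_lift.
exact: addIn.
Qed.

Lemma trunc_congr P :
  ideal_gen qpowers (P - \sum_a P@_(box_mnm a) *: 'X_[box_mnm a]).
Proof.
have [b0 bD bM] := ideal_gen_ideal qpowers.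
elim/mpolyind: P => [|c m P _ _ IHP].
  by rewrite big1 ?subr0 // => a _; rewrite mcoeff0 scale0r.
rewrite (eq_bigr (fun a => (c *: 'X_[m])@_(box_mnm a) *: 'X_[box_mnm a]
    + P@_(box_mnm a) *: 'X_[box_mnm a])); last first.
  by move=> a _; rewrite mcoeffD scalerDl.
rewrite big_split /= opprD addrACA; apply: bD => //.
have [/forallP/box_mnmP[a ->]|] := boolP [forall j, m j < q]%N.
  rewrite (bigD1 a) //= big1 ?addr0 => [|a' /negPf na].
    by rewrite mcoeffZ mcoeffX eqxx mulr1 subrr.
  by rewrite mcoeffZ mcoeffX (inj_eq box_mnm_inj) eq_sym na mulr0 scale0r.
rewrite negb_forall => /existsP[j]; rewrite -leqNgt => qm.
rewrite big1 ?subr0 => [|a _].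
  by rewrite -mul_mpolyC; apply: bM; apply: mpolyX_qpowers qm.
rewrite mcoeffZ mcoeffX; case: eqP => [def_m|_]; last by rewrite mulr0 scale0r.
by move: qm; rewrite def_m mnmE leqNgt ltn_ord.
Qed.

Lemma trunc_graded P : \sum_a P@_(box_mnm a) *: 'X_[box_mnm a] =
  \sum_(d < (n.+1 * q).+1) of_coords (coords d P).
Proof.
have le_deg a : (mdeg (box_mnm a) < (n.+1 * q).+1)%N.
  rewrite ltnS mdegE -[in leqRHS](card_ord n.+1) -sum_nat_const.
  by apply: leq_sum => j _; rewrite mnmE ltnW.
rewrite (partition_big (fun a => Ordinal (le_deg a)) xpredT) //=.
apply: eq_bigr => d _; rewrite /of_coords.
under [RHS]eq_bigr do rewrite mxE.
rewrite -(@big_enum_val _ _ _ _ (mem (box d))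
  (fun a => P@_(box_mnm a) *: 'X_[box_mnm a])).
by apply: eq_bigl => a; rewrite inE -val_eqE.
Qed.

Section Relations.
Variables (r D : nat) (f : 'I_r -> S).
Hypothesis f_homog : forall j, exists d, forall m, m \in msupp (f j) -> mdeg m = d.
Hypothesis f_size : forall j m, (size (f j)@_m <= D.+1)%N.

(** The ideal (f_1, ..., f_r) + (x_1^q, ..., x_(n+1)^q). *)
Definition graded_ideal : set S := ideal_gen (range f `|` qpowers).

Definition relations d : set 'rV[R]_#|box d| :=
  [set v | exists (m : 'X_{1..n.+1}) (j : 'I_r), v = coords d (f j * 'X_[m])].
Arguments relations : clear implicits.

Lemma size_relations d v : relations d v -> forall i, (size (v ord0 i) <= D.+1)%N.
Proof.
by case=> m [j ->] i; rewrite mxE mcoeffMXE; case: ifP; rewrite ?size_poly0.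
Qed.

Lemma qpowers_sub : ideal_gen qpowers `<=` graded_ideal.
Proof.
apply: ideal_gen_min; first exact: ideal_gen_ideal.
by move=> x qx; apply: ideal_gen_sub; right.
Qed.

(** Taking coordinates is K[t]-linear but not S-linear, so membership is
    tracked for all multiples of P at once. *)
Lemma coords_graded_ideal d P : graded_ideal P -> span (relations d) (coords d P).
Proof.
have [s0 sD sZ] := span_submod (relations d).
pose M := [set x : S | forall s, span (relations d) (coords d (s * x))].
suff fM : graded_ideal `<=` M by move=> /fM/(_ 1); rewrite mul1r.
apply: ideal_gen_min; first split.
- by move=> s; rewrite mulr0 coords0.
- by move=> x y sx sy s; rewrite mulrDr coordsD; apply: sD.
- by move=> a x sx s; rewrite mulrA.
move=> x [[j _ <-]|[i _ <-]] s.
  rewrite [s]mpolyE mulr_suml.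
  elim: (msupp s) => [|m ms IH]; first by rewrite big_nil coords0.
  rewrite big_cons coordsD; apply: sD => //.
  rewrite -scalerAl coordsZ; apply: sZ => L [_]; apply.
  by exists m, j; rewrite mulrC.
suff -> : coords d (s * 'X_i ^+ q) = 0 by [].
apply/rowP=> k; rewrite !mxE mpolyXn mcoeffMXE; case: ifP => // /mnm_lepP/(_ i).
by rewrite mulmnE mnm1E eqxx mul1n mnmE leqNgt ltn_ord.
Qed.

(** This is where homogeneity enters: f_j times a monomial has coordinates in
    one degree only, hence is recovered modulo qpowers from these
    coordinates. *)
Lemma of_coords_graded_ideal d v : (d < (n.+1 * q).+1)%N ->
  span (relations d) v -> graded_ideal (of_coords v).
Proof.
have [b0 bD bM] := ideal_gen_ideal (range f `|` qpowers).
pose M := [set v : 'rV_#|box d| | graded_ideal (of_coords v)].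
move=> dlt /(_ M); apply; split; rewrite /M.
  split=> [|x y|a x] /=; rewrite ?of_coords0 ?of_coordsD ?of_coordsZ //.
    exact: bD.
  by rewrite -mul_mpolyC; apply: bM.
move=> _ [m [j ->]] /=; have [e f_e] := f_homog j.
set P := f j * _; have Pe d' : d' != (e + mdeg m)%N -> coords d' P = 0.
  move=> nd; apply/rowP=> i; rewrite !mxE mcoeffMXE; case: ifP => // mk.
  apply: memN_msupp_eq0; apply: contra nd => /f_e <-; rewrite -mdegD submK //.
  by have := enum_valP i; rewrite inE eq_sym.
have [def_d|/Pe ->] := eqVneq d (e + mdeg m)%N; last by rewrite of_coords0.
have fP : graded_ideal P.
  by rewrite /P mulrC; apply: bM; apply: ideal_gen_sub; left; exists j.
have := trunc_congr P; rewrite trunc_graded (bigD1 (Ordinal dlt)) //= big1 => [|i].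
  move=> /qpowers_sub; rewrite addr0 => h.
  by rewrite -[of_coords _](subKr P); apply: (idealB (ideal_gen_ideal _)).
by rewrite -val_eqE /= def_d => /Pe ->; rewrite of_coords0.
Qed.

(** Each degree d contributes its own minor delta d, of degree at most D q^n.
    Degrees above (n + 1) q contain no monomial with exponents below q. *)
Lemma graded_torsion : exists delta : nat -> R,
  (forall d, delta d != 0 /\ (size (delta d) <= (D * q ^ n).+1)%N) /\
  forall G, (forall d, (d < (n.+1 * q).+1)%N -> delta d %| G) ->
  forall h P, h != 0 -> graded_ideal (h *: P) -> graded_ideal (G *: P).
Proof.
have [b0 bD bM] := ideal_gen_ideal (range f `|` qpowers).
have [delta deltaP] := boolp.choice (fun d => torsion_killer (@size_relations d)).
exists delta; split=> [d|G Gd h P h0 hP].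
  have [d0 szd _] := deltaP d; split=> //; apply: leq_trans szd _.
  by rewrite ltnS leq_mul2l card_box orbT.
have := trunc_congr P; rewrite trunc_graded => /qpowers_sub trP.
rewrite -mul_mpolyC -[P](subrK (\sum_(d < (n.+1 * q).+1) of_coords (coords d P))).
rewrite mulrDr; apply: (bD); first exact: bM.
rewrite mulr_sumr; apply: (big_ind graded_ideal b0 bD) => d _.
have [_ _ kill] := deltaP d.
have [s def_G] := dvdpP _ _ (Gd d (ltn_ord d)).
rewrite mul_mpolyC -of_coordsZ; apply: of_coords_graded_ideal (ltn_ord d) _.
rewrite def_G -scalerA; have [_ _ sZ] := span_submod (relations d); apply: sZ.
by apply: (kill h) => //; rewrite -coordsZ; apply: coords_graded_ideal.
Qed.

End Relations.
End TruncatedCoordinates.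

(** * Separating t from the other variables *)

(** Induction for properties that respect the ring structure, such as the
    agreement of two ring morphisms: constants and variables suffice. *)
Lemma mpoly_ring_ind (n : nat) (R : comNzRingType) (T : {mpoly R[n]} -> Prop) :
    (forall c, T c%:MP) -> (forall i, T 'X_i) ->
    (forall P Q, T P -> T Q -> T (P + Q)) ->
    (forall P Q, T P -> T Q -> T (P * Q)) ->
  forall P, T P.
Proof.
move=> TC TX TD TM P; rewrite [P]mpolyE; apply: big_ind => //.
  by rewrite -mpolyC0.
move=> m _; rewrite -mul_mpolyC mpolyXE_id; apply: (TM) => //.
apply: big_ind => [|//|i _]; first by rewrite -mpolyC1.
by elim: (m i) => [|a IH]; rewrite ?expr0 -?mpolyC1 // exprS; apply: TM.
Qed.

(** The ring k[t, x_1, ..., x_n] is carried to k[t][x_1, ..., x_n], where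
    coefficients are elements of k[t] and the grading by the degree in x is
    the usual total degree. *)
Section Separation.
Variables (k : fieldType) (n : nat).
Local Notation S := {mpoly k[n.+1]}.
Local Notation S' := {mpoly {poly k}[n]}.

Definition in_t : {poly k} -> S := horner_alg 'X_ord0.
HB.instance Definition _ := GRing.RMorphism.on in_t.

Definition sep_var (i : 'I_n.+1) : S' :=
  if unlift ord0 i is Some j then 'X_j else 'X%:MP.

Definition sep : S -> S' := mmap (@mpolyC n {poly k} \o polyC) sep_var.
HB.instance Definition _ := GRing.RMorphism.on sep.

Definition unsep : S' -> S := mmap in_t (fun j => 'X_(lift ord0 j)).
HB.instance Definition _ := GRing.RMorphism.on unsep.

Lemma sepX i : sep 'X_i = sep_var i.
Proof. by rewrite /sep mmapX mmap1U. Qed.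

Lemma unsepX j : unsep 'X_j = 'X_(lift ord0 j).
Proof. by rewrite /unsep mmapX mmap1U. Qed.

Lemma in_tX : in_t 'X = 'X_ord0.
Proof. by rewrite /in_t /horner_alg horner_morphX. Qed.

Lemma in_tC c : in_t c%:P = c%:MP.
Proof. by rewrite /in_t /horner_alg horner_morphC /= -mul_mpolyC mulr1. Qed.

Lemma sepK : cancel sep unsep.
Proof.
apply: mpoly_ring_ind => [c|i|P Q eP eQ|P Q eP eQ].
- by rewrite /sep mmapC /unsep mmapC; apply: in_tC.
- rewrite sepX /sep_var; case: unliftP => [j|] ->; first by rewrite unsepX.
  by rewrite /unsep mmapC; apply: in_tX.
- by rewrite !rmorphD /= eP eQ.
by rewrite !rmorphM /= eP eQ.
Qed.

Lemma sep_in_t h : sep (in_t h) = h%:MP.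
Proof.
elim/poly_ind: h => [|h c IHh]; first by rewrite !rmorph0.
rewrite !rmorphD !rmorphM /= IHh in_tX in_tC sepX /sep_var unlift_none.
by rewrite /sep mmapC.
Qed.

Definition tail (m : 'X_{1..n.+1}) : 'X_{1..n} := [multinom m (lift ord0 i) | i < n].

Lemma sepE P :
  sep P = \sum_(m <- msupp P) ((P@_m)%:P * 'X^(m ord0)) *: 'X_[tail m].
Proof.
apply: eq_bigr => m _; rewrite /mmap1 big_ord_recl /= {1}/sep_var unlift_none.
rewrite -rmorphXn mulrA -rmorphM /= mul_mpolyC mpolyXE_id; congr (_ *: _).
by apply: eq_bigr => j _; rewrite /sep_var liftK mnmE.
Qed.

Lemma sep_homog P : P \is homog (@xdeg n) ->
  exists d, forall m, m \in msupp (sep P) -> mdeg m = d.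
Proof.
case/homogP => d /dhomogP Pd; exists d; apply/dhomogP.
rewrite sepE big_seq; apply: rpred_sum => m mP; apply: rpredZ.
rewrite dhomogX -(Pd m mP) /= mdegE /xdeg; apply/eqP.
by apply: eq_bigr => i _; rewrite mnmE.
Qed.

End Separation.

(** * The theorem *)

Section FrobeniusPower.
Variables (k : fieldType) (p n r : nat) (f : 'I_r -> {mpoly k[n.+2]}) (e : nat).
Hypothesis charkp : p \in [pchar k].
Local Notation A := (hquot f).
Local Notation q := (p ^ e)%N.
Local Notation proj := (quot_pi (range f)).

Lemma pchar_hquot : p%:R = 0 :> A.
Proof.
have -> : p%:R = proj (p%:R : k)%:MP_[n.+2] by rewrite !rmorph_nat.
by rewrite (pcharf0 charkp) !rmorph0.
Qed.

(** Membership in the Frobenius power of I is moved from the quotient ring to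
    an ideal of a polynomial ring over k[t], where coordinates exist. *)
Lemma frob_power_xidealP P : frob_power (xideal f) q (proj P) <->
  graded_ideal q (fun j => sep (f j)) (sep P).
Proof.
set b := graded_ideal _ _.
have idb : is_ideal b by apply: ideal_gen_ideal.
have idf := ideal_gen_ideal (range f).
have bf : ideal_gen (range f) `<=` [set Q | b (sep Q)].
  have [b0 bD bM] := idb.
  apply: ideal_gen_min => [|_ [j _ <-]]; last by apply: ideal_gen_sub; left; exists j.
  split=> [|x y|a x] /=; rewrite ?rmorph0 ?rmorphD ?rmorphM //; [exact: bD|exact: bM].
rewrite (frob_power_gen _ _ (pcharf_prime charkp) pchar_hquot).
set J := ideal_gen _; have [J0 JD JM] : is_ideal J by apply: ideal_gen_ideal.
split=> [JP|].
  pose L := [set v : A | exists2 Q, v = proj Q & b (sep Q)].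
  have [b0 bD bM] := idb.
  have [Q /eqP] : L (proj P).
    apply: (ideal_gen_min _ _ JP).
      split=> [|_ _ [x -> bx] [y -> by_]|a _ [x -> bx]].
      - by exists 0; rewrite rmorph0.
      - by exists (x + y); rewrite rmorphD //; apply: bD.
      - have [a' <-] := quot_pi_surj a.
        by exists (a' * x); rewrite rmorphM //; apply: bM.
    move=> _ [_ [i _ <-] <-]; exists ('X_(lift ord0 i) ^+ q); first by rewrite rmorphXn.
    rewrite rmorphXn /= sepX /sep_var liftK.
    by apply: ideal_gen_sub; right; exists i.
  rewrite -subr_eq0 -rmorphB => /eqP/quot_pi_eq0/bf /=.
  by rewrite rmorphB; apply: ideal_congr_mem.
rewrite -{2}[P]sepK; move: (sep P); apply: ideal_gen_min.
  split=> [|x y|a x] /=; rewrite ?rmorph0 ?rmorphD ?rmorphM //; [exact: JD|exact: JM].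
move=> _ [[j _ <-]|[i _ <-]] /=.
  rewrite sepK; have -> // : proj (f j) = 0.
  by apply/quot_pi_eq0; apply: ideal_gen_sub; exists j.
rewrite !rmorphXn /= unsepX.
by apply: ideal_gen_sub; exists (proj 'X_(lift ord0 i)) => //; exists i.
Qed.

Lemma hquot_split (v : A) : exists h, xideal f (v - proj (in_t n.+1 h)).
Proof.
have idI : is_ideal (xideal f) by apply: ideal_gen_ideal.
have [I0 ID IM] := idI.
have [P <-] := quot_pi_surj v; elim/mpoly_ring_ind: P =>
  [c|i|P Q [g Pg] [h Qh]|P Q [g Pg] [h Qh]].
- by exists c%:P; rewrite in_tC subrr.
- case: (unliftP ord0 i) => [j|] ->; last by exists 'X; rewrite in_tX subrr.
  by exists 0; rewrite !rmorph0 subr0; apply: ideal_gen_sub; exists j.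
- exists (g + h); rewrite !rmorphD opprD addrACA; exact: ID.
by exists (g * h); rewrite !rmorphM; apply: (ideal_congrM idI).
Qed.

End FrobeniusPower.

Theorem theorem3p4 (k : fieldType) (p : nat) (charkp : p \in [pchar k])
    (n : nat) (n_ge2 : (2 <= n)%N)
    (r : nat) (f : 'I_r -> {mpoly k[n.+1]})
    (f_homog : forall i : 'I_r, f i \is homog (@xdeg n)) :
  exists c : nat, (0 < c)%N /\
    forall (e : nat) (q : nat), q = (p ^ e)%N ->
      exists (m : nat) (Q : 'I_m -> set (hquot f)),
        primary_decomposition (frob_power (xideal f) q) Q /\
        forall i : 'I_m,
          frob_power (ideal_pow (radical (Q i)) c) (q ^ (n - 1)) `<=` Q i.
Proof.
have p_pr := pcharf_prime charkp.
case: n n_ge2 => [//|n] n_gt0 in f f_homog *; rewrite ltnS in n_gt0.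
pose F j := sep (f j).
pose D := \max_(j < r) \max_(m <- msupp (F j)) size (F j)@_m.
have F_homog j : exists d, forall m, m \in msupp (F j) -> mdeg m = d.
  exact: sep_homog.
have F_size j m : (size (F j)@_m <= D.+1)%N.
  have [mF|/memN_msupp_eq0 ->] := boolP (m \in msupp (F j)); last by rewrite size_poly0.
  apply: leqW; apply: leq_trans (leq_bigmax j).
  exact: (@leq_bigmax_seq _ _ xpredT (fun m => size (F j)@_m)).
exists D.+1; split=> // e q ->; rewrite subn1 /= -expnM.
have [delta [deltaP kill]] := graded_torsion (p ^ e) F_homog F_size.
pose H := \prod_(d < (n.+1 * p ^ e).+1) delta d.
have H0 : H != 0 by apply/prodf_neq0 => d _; case: (deltaP d).
have [gs [irr cop [M HM]]] := coprime_factorization H0.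
pose tau := quot_pi (range f) \o in_t n.+1.
apply: (@frobenius_decomposition _ _ tau p (xideal f) e _ _ _ _ gs) => //.
- exact: pchar_hquot.
- exact: ideal_gen_ideal.
- exact: hquot_split.
- by rewrite -{1}[e]muln1 leq_mul2l n_gt0 orbT.
move=> h u h0; have [P <-] := quot_pi_surj u.
have tauM g : tau g * quot_pi (range f) P = quot_pi (range f) (in_t n.+1 g * P).
  by rewrite rmorphM.
rewrite !tauM !frob_power_xidealP // !rmorphM /= !sep_in_t !mul_mpolyC.
apply: kill h0 => d dlt; have [d0 szd] := deltaP d.
apply: (@dvdp_exp_bound _ _ _ M) => //; last first.
  by apply: dvdp_trans HM; rewrite /H (bigD1 (Ordinal dlt)) //= dvdp_mulr.
by apply: leq_trans szd _; rewrite ltnS expnM leq_mul2r leqnSn orbT.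
Qed.
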